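(* Let $\mathcal{S}$ be a finite connected poset and let $\mathcal{A}=\mathcal{S}$. Then monotonicity equivalence holds for $(\mathcal{A},\mathcal{S})$ if and only if $\mathcal{S}$ is an acyclic poset.
   Context: All posets are finite. For a poset $\mathcal{S}$ with ground set $S$: $y$ covers $x$ if $x<y$ and no $z\in S$ satisfies $x<z<y$. The cover graph of $\mathcal{S}$ is the undirected graph on $S$ whose edges are the pairs $\{x,y\}$ such that one of $x,y$ covers the other. $\mathcal{S}$ is connected if its cover graph is connected, and acyclic if its cover graph contains no cycle (in the usual graph-theoretic sense). An up-set of $\mathcal{S}$ is a set $U\subseteq S$ such that $x\in U$ and $x\le y$ imply $y\in U$. For probability measures $P_1,P_2$ on $S$, write $P_1\preceq P_2$ if $P_1(U)\le P_2(U)$ for every up-set $U$ of $\mathcal{S}$. Let $\mathcal{A}$ (ground set $A$) and $\mathcal{S}$ (ground set $S$) be finite posets and let $(P_\alpha:\alpha\in A)$ be a system of probability measures on $S$. The system is stochastically monotone if $P_\alpha\preceq P_\beta$ whenever $\alpha\le\beta$ in $\mathcal{A}$. It is realizably monotone if there exist $S$-valued random variables $(\mathbf{X}_\alpha:\alpha\in A)$ on a common probability space such that $\mathbf{X}_\alpha\le\mathbf{X}_\beta$ in $\mathcal{S}$ whenever $\alpha\le\beta$ in $\mathcal{A}$, and $\mathbf{X}_\alpha$ has distribution $P_\alpha$ for every $\alpha\in A$. Monotonicity equivalence holds for $(\mathcal{A},\mathcal{S})$ if every stochastically monotone system $(P_\alpha:\alpha\in A)$ of probability measures on $S$ is realizably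 monotone. *)

(* Defs.v *)
From HB Require Import structures.
From mathcomp Require Import all_boot all_order all_algebra.
From mathcomp Require Import all_classical all_reals all_analysis.

Set Implicit Arguments.
Unset Strict Implicit.
Unset Printing Implicit Defensive.

Import Order.TTheory GRing.Theory Num.Theory.

Local Open Scope classical_set_scope.
Local Open Scope order_scope.

Section CoverGraph.
Context {d : Order.disp_t} (S : finPOrderType d).

Definition covers (y x : S) : bool :=
  (x < y) && ~~ [exists z : S, (x < z) && (z < y)].

Definition cover_graph : rel S := fun x y => covers x y || covers y x.

Definition poset_connected : Prop := forall x y : S, connect cover_graph x y.

(* A graph cycle has at least three vertices; ucycle alone would also accept
   the empty sequence and a single edge traversed back and forth. *)
Definition poset_acyclic : Prop :=
  forall c : seq S, (2 < size c)%N -> ~ ucycle cover_graph c.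

Definition up_set (U : set S) : Prop :=
  forall x y : S, U x -> x <= y -> U y.

End CoverGraph.

(* T with the sigma-algebra of all its subsets. The library requires measurable
   types to be pointed, whence the parameter x0, which plays no other role. *)
Definition discrete_space (T : choiceType) (x0 : T) : Type := T.

Section DiscreteSpace.
Variables (T : choiceType) (x0 : T).

HB.instance Definition _ := Choice.copy (discrete_space x0) T.
HB.instance Definition _ := isPointed.Build (discrete_space x0) x0.
HB.instance Definition _ := @isMeasurable.Build default_measure_display
  (discrete_space x0) discrete_measurable discrete_measurable0
  discrete_measurableC discrete_measurableU.

End DiscreteSpace.

Section Monotonicity.
Context {dA dS : Order.disp_t} (A : finPOrderType dA) (S : finPOrderType dS).
Context (R : realType) (x0 : S).

Definition stochastic_le (P1 P2 : probability (discrete_space x0) R) : Prop :=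
  forall U : set S, up_set U -> (P1 U <= P2 U)%E.

Definition stochastically_monotone
    (P : A -> probability (discrete_space x0) R) : Prop :=
  forall a b : A, a <= b -> stochastic_le (P a) (P b).

Definition realizably_monotone
    (P : A -> probability (discrete_space x0) R) : Prop :=
  exists (d : measure_display) (Omega : measurableType d)
         (Pr : probability Omega R)
         (X : A -> {RV Pr >-> discrete_space x0}),
    (forall a b : A, a <= b ->
       forall w : Omega, (X a w : S) <= (X b w : S)) /\
    (forall (a : A) (U : set S), distribution Pr (X a) U = P a U).

End Monotonicity.

(* When S is empty there is no x0 and the property is vacuous, as it should be:
   an empty S carries no probability measure, and for empty A the empty system
   is trivially realizable. *)
Definition monotonicity_equivalence (R : realType) {dA dS : Order.disp_t}
    (A : finPOrderType dA) (S : finPOrderType dS) : Prop :=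
  forall (x0 : S) (P : A -> probability (discrete_space x0) R),
    stochastically_monotone P -> realizably_monotone P.

(* Main.v *)
From HB Require Import structures.
Require Import Defs.
From mathcomp Require Import all_boot all_order all_algebra.
From mathcomp Require Import all_classical all_reals all_analysis.
From mathcomp Require Import zify.

(** If the cover graph is a forest, Strassen's theorem couples P_a and P_b along
    every edge, and the couplings are glued into one joint law by adding the
    vertices leaf by leaf, each new value being drawn from its conditional law
    given the value at the only neighbour already present.

    If the cover graph has a cycle, let P_a be uniform on C minus the point q a,
    where q is antitone and its image C is a cycle around which q turns once.
    When a moves along the cycle, the "hole" q a moves one step the other way,
    and monotonicity forces every value X_a to stay put unless it is hit by the
    hole, which then swaps places with it.  After one full turn the values are
    cyclically shifted among the points of C, so X_a differs from itself.

    Such a q exists.  If some interval contains two incomparable elements,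
    [x < y, z < w], map a to the corner of this diamond described by the two
    bits [y <= a] and [z <= a], complemented.  Otherwise remove an edge [u < v]
    of the cycle and map a to its fence distance from the up-set of v, capped at
    its least value M below u; a shortest fence realizing M is closed up by the
    removed edge into a crown, onto which this map is a retraction; q is this
    retraction followed by an order-reversing reflection of the crown. *)

Set Implicit Arguments.
Unset Strict Implicit.
Unset Printing Implicit Defensive.

Import Order.TTheory GRing.Theory Num.Theory.

Local Open Scope ring_scope.

(** * Strassen's theorem on finite posets *)

Lemma sum_setUI (R : nmodType) (T : finType) (F : T -> R) (A B : {set T}) :
  \sum_(x in A :|: B) F x + \sum_(x in A :&: B) F x
    = \sum_(x in A) F x + \sum_(x in B) F x.
Proof.
have mk C : \sum_(x in C) F x = \sum_x (if x \in C then F x else 0).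
  exact: big_mkcond.
rewrite !mk -!big_split; apply: eq_bigr => x _ /=.
by rewrite !inE; case: (x \in A); case: (x \in B); rewrite ?addr0 ?add0r.
Qed.

Lemma sum_subset_le (R : numDomainType) (T : finType) (F : T -> R)
    (A B : {set T}) :
  (forall x, 0 <= F x) -> A \subset B ->
  \sum_(x in A) F x <= \sum_(x in B) F x.
Proof.
move=> F0 AB; rewrite [leRHS](big_setID A) /= (finset.setIidPr AB) lerDl.
exact: sumr_ge0.
Qed.

Lemma sum_sub_point (R : zmodType) (T : finType) (F : T -> R) (t : T) (e : R)
    (P : pred T) :
  \sum_(x | P x) (F x - (if x == t then e else 0))
    = \sum_(x | P x) F x - (if P t then e else 0).
Proof.
rewrite sumrB; congr (_ - _); rewrite -big_mkcondr /=.
case: ifP => Pt.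
  by rewrite (big_pred1 t) // => x /=; rewrite andbC; case: eqP => // ->.
by rewrite big_pred0 // => x; case: eqP => [->|]; rewrite ?Pt ?andbF.
Qed.

Definition neighbors (X Y : finType) (E : {set X * Y}) (B : {set X}) : {set Y} :=
  [set y | [exists x in B, (x, y) \in E]].

Lemma neighborsP (X Y : finType) (E : {set X * Y}) (B : {set X}) (y : Y) :
  reflect (exists2 x, x \in B & (x, y) \in E) (y \in neighbors E B).
Proof.
rewrite inE; apply: (iffP existsP) => [[x /andP[]]|[x xB xy]]; exists x => //.
by rewrite xB.
Qed.

(* By induction on the number of edges.  Deleting an edge (x, y) violates Hall's
   condition by at most [e]; sending exactly [e] through that edge first restores
   the condition, by submodularity at a worst set [Bm]. *)
Lemma fractional_hall (R : realFieldType) (X Y : finType) (E : {set X * Y})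
    (p : X -> R) (q : Y -> R) :
  (forall x, 0 <= p x) -> (forall y, 0 <= q y) ->
  (forall B : {set X}, \sum_(x in B) p x <= \sum_(y in neighbors E B) q y) ->
  exists f : X -> Y -> R,
    [/\ forall x y, 0 <= f x y, forall x y, (x, y) \notin E -> f x y = 0,
        forall x, \sum_y f x y = p x & forall y, \sum_x f x y <= q y].
Proof.
have [n] := ubnP #|E|; elim: n E p q => // n IHn E p q En p0 q0 hall.
have [E0|[[x y] xyE]] := set_0Vmem E.
  exists (fun _ _ => 0); split=> // [x|y]; rewrite big1 //.
  apply/esym/eqP; rewrite eq_le p0 andbT.
  have := hall [set x]; rewrite big_set1 (_ : neighbors _ _ = finset.set0) ?big_set0 //.
  apply/finset.setP=> y; rewrite finset.in_set0; apply/neighborsP => -[z _].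
  by rewrite E0 finset.in_set0.
set E' := E :\ (x, y).
have inE' a b : ((a, b) \in E') = ((a, b) != (x, y)) && ((a, b) \in E).
  by rewrite in_setD1.
have E'n : (#|E'| < n)%N by move: En; rewrite (cardsD1 (x, y)) xyE.
have NE' (B : {set X}) : neighbors E' B \subset neighbors E B.
  apply/fintype.subsetP => z /neighborsP[t tB].
  by rewrite inE' => /andP[_ tz]; apply/neighborsP; exists t.
have NE'y (B : {set X}) : neighbors E B \subset y |: neighbors E' B.
  apply/fintype.subsetP => z /neighborsP[t tB tz]; rewrite in_setU1.
  case: eqP => //= zy; apply/neighborsP; exists t => //; rewrite inE' tz andbT.
  by apply/eqP => -[_ /zy].
have NE'x (B : {set X}) : x \notin B -> neighbors E B = neighbors E' B.
  move=> xB; apply/eqP; rewrite finset.eqEsubset NE' andbT.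
  apply/fintype.subsetP => z /neighborsP[t tB tz].
  apply/neighborsP; exists t => //; rewrite inE' tz andbT.
  by apply/eqP => -[tx _]; rewrite -tx tB in xB.
have NE'in (B : {set X}) : y \in neighbors E' B -> neighbors E B = neighbors E' B.
  move=> yB; apply/eqP; rewrite finset.eqEsubset NE' andbT.
  by apply: fintype.subset_trans (NE'y _) _; rewrite finset.subUset finset.sub1set yB /=.
(* The amount by which [B] violates Hall's condition once the edge is deleted. *)
pose slack (B : {set X}) : R := \sum_(x in B) p x - \sum_(y in neighbors E' B) q y.
have [hall'|] := boolP [forall B : {set X}, slack B <= 0].
  have [//|//|B|f [f0 fE fp fq]] := IHn E' p q E'n.
    by rewrite -subr_le0; exact: (forallP hall').
  by exists f; split=> // a b ab; apply: fE; rewrite inE' (negbTE ab) andbF.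
case/forallPn => B0; rewrite -ltNge => B0_gt0.
pose Bm : {set X} := [arg max_(B > B0) slack B]%O.
have Bmax B : slack B <= slack Bm.
  by rewrite /Bm; case: arg_maxP => //= B1 _; apply.
set e := slack Bm in Bmax.
have e_gt0 : 0 < e by apply: lt_le_trans (Bmax B0).
have Bm_neq : neighbors E Bm <> neighbors E' Bm.
  move=> eqN; move: (hall Bm); rewrite -subr_le0 eqN -/(slack Bm) -/e.
  by rewrite leNgt e_gt0.
have xBm : x \in Bm by apply/negPn/negP => /NE'x.
have yBm : y \notin neighbors E' Bm by apply/negP => /NE'in.
(* Deleting the edge does not affect [Bm :\ x], which therefore satisfies Hall's condition; the
   violation at [Bm] is at most the mass of [x]. *)
have ep : e <= p x.
  have := hall (Bm :\ x); rewrite NE'x ?setD11 // => H.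
  rewrite /e /slack (big_setD1 x) //= -addrA gerDl subr_le0.
  apply: le_trans H _; apply: sum_subset_le => //.
  apply/fintype.subsetP => z /neighborsP[t].
  by rewrite in_setD1 => /andP[_ tB] tz; apply/neighborsP; exists t.
have eq_ : e <= q y.
  rewrite /e /slack lerBlDr; apply: le_trans (hall Bm) _.
  by rewrite -big_setU1 //; apply: sum_subset_le.
have [t|t|B|f [f0 fE fp fq]] := IHn E' (fun t => p t - (if t == x then e else 0))
    (fun t => q t - (if t == y then e else 0)) E'n.
- by case: eqP => [->|_]; rewrite ?subr_ge0 ?subr0.
- by case: eqP => [->|_]; rewrite ?subr_ge0 ?subr0.
- rewrite !sum_sub_point; have [yB|yB] := boolP (y \in _); last first.
    rewrite subr0; case: ifP => xB; first by rewrite lerBlDr addrC -lerBlDr Bmax.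
    by rewrite subr0 -NE'x ?xB.
  have NB := NE'in _ yB.
  case: ifP => xB; first by rewrite lerD2r -NB.
  (* Add Hall's condition for [E] at [B :|: Bm] and at [B :&: Bm]. The union loses no neighbor, as
     [y] is still reached from [B]; the intersection misses [x], so it does not use the deleted
     edge. *)
  rewrite subr0 lerBrDr -NB /e /slack addrA lerBlDr -(sum_setUI p) -(sum_setUI q).
  apply: lerD; apply: le_trans (hall _) _; apply: sum_subset_le => //.
    apply/fintype.subsetP => z /neighborsP[t]; rewrite finset.in_setU.
    case/orP=> tB tz; rewrite finset.in_setU.
      by apply/orP; left; apply/neighborsP; exists t.
    have : z \in neighbors E Bm by apply/neighborsP; exists t.
    move=> /(fintype.subsetP (NE'y _)); rewrite in_setU1.
    by case/orP=> [/eqP->|->]; rewrite ?orbT // NB yB.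
  apply/fintype.subsetP => z /neighborsP[t]; rewrite !finset.in_setI.
  case/andP=> tB tBm tz; apply/andP; split; apply/neighborsP; exists t => //.
  by rewrite inE' tz andbT; apply/eqP => -[tx _]; rewrite -tx tB in xB.
exists (fun a b => f a b + (if (a, b) == (x, y) then e else 0)); split.
- by move=> a b; rewrite addr_ge0 //; case: ifP => // _; exact: ltW.
- move=> a b abE; rewrite fE ?inE' ?(negbTE abE) ?andbF // add0r.
  by case: eqP => // abxy; rewrite abxy xyE in abE.
- move=> a; rewrite big_split /= fp.
  have [->|ax] := eqVneq a x.
    rewrite -[in X in _ + X]big_mkcond (big_pred1 y) ?subrK // => b.
    by rewrite /= xpair_eqE eqxx.
  by rewrite big1 ?subr0 ?addr0 // => b _; rewrite xpair_eqE (negbTE ax).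
- move=> b; rewrite big_split /= -lerBrDr; apply: le_trans (fq b) _.
  rewrite lerD2l lerN2.
  have [->|bY] := eqVneq b y.
    rewrite -[in X in X <= _]big_mkcond (big_pred1 x) // => a.
    by rewrite /= xpair_eqE eqxx andbT.
  by rewrite big1 // => a _; rewrite xpair_eqE (negbTE bY) andbF.
Qed.

(** For the relation [<=], [neighbors E B] is the up-set generated by [B], so dominance on up-sets
    yields Hall's condition. Column sums are then at most [q], and equal total masses leave no
    gap. *)
Lemma strassen (R : realFieldType) (d : Order.disp_t) (S : finPOrderType d)
    (p q : S -> R) :
  (forall x, 0 <= p x) -> (forall y, 0 <= q y) ->
  \sum_x p x = \sum_y q y ->
  (forall U : {set S}, (forall x y, x \in U -> (x <= y)%O -> y \in U) ->
    \sum_(x in U) p x <= \sum_(y in U) q y) ->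
  exists f : S -> S -> R,
    [/\ forall x y, 0 <= f x y, forall x y, f x y != 0 -> (x <= y)%O,
        forall x, \sum_y f x y = p x & forall y, \sum_x f x y = q y].
Proof.
move=> p0 q0 pq dom; pose E : {set S * S} := [set xy | (xy.1 <= xy.2)%O].
have [B|f [f0 fE fp fq]] := @fractional_hall R S S E p q p0 q0.
  apply: (@le_trans _ _ (\sum_(x in neighbors E B) p x)).
    apply: sum_subset_le => //; apply/fintype.subsetP => x xB.
    by apply/neighborsP; exists x; rewrite // inE /=.
  apply: dom => x y /neighborsP[z zB]; rewrite inE /= => zx xy.
  by apply/neighborsP; exists z => //; rewrite inE /= (le_trans zx).
exists f; split=> // [x y|y].
  by apply: contraNT => xy; rewrite fE // inE.
have gap0 : \sum_y (q y - \sum_x f x y) = 0.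
  by rewrite sumrB -pq exchange_big /= -sumrB big1 // => x _; rewrite fp subrr.
apply/esym/eqP; rewrite -subr_eq0; apply/eqP.
by apply: (psumr_eq0P _ gap0) => // z _; rewrite subr_ge0.
Qed.

(** * Gluing couplings along a forest *)

(** Without a leaf, paths in [T] grow forever at their head [x]: a neighbor of [x] already on the
    path must be the next vertex, or it would close a cycle, so one of two distinct neighbors is
    new. *)
Lemma acyclic_has_leaf (V : finType) (e : rel V) (T : {set V}) (v0 : V) :
  symmetric e -> irreflexive e ->
  (forall c : seq V, (2 < size c)%N -> ~ ucycle e c) -> v0 \in T ->
  exists2 l, l \in T &
    forall a b, a \in T -> b \in T -> e l a -> e l b -> a = b.
Proof.
move=> e_sym e_irr acyc v0T; apply: contrapT => noleaf.
have two l : l \in T -> exists a b,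
    [/\ a \in T, b \in T, e l a, e l b & a != b].
  move=> lT; apply: contrapT => H; apply: noleaf; exists l => // a b aT bT la lb.
  by apply/eqP/negPn/negP => ab; apply: H; exists a, b.
have closes x p a : path e x p -> uniq (x :: p) -> e x a -> a \in p ->
    a = head x p.
  move=> ep up xa ap; case/splitPr: ap ep up => -[//|y p1] p2 ep up.
  case: (acyc (x :: rcons (y :: p1) a)); first by rewrite /= size_rcons.
  move: ep; rewrite -cat_rcons cat_path => /andP[ep _].
  apply/andP; split.
    by rewrite -[cycle _ _]/(path e x (rcons (rcons (y :: p1) a) x)) rcons_path ep
      last_rcons e_sym.
  move: up; rewrite -cat_rcons -cat_cons cat_uniq => /andP[]//.
have long n : exists x p,
    [/\ path e x p, uniq (x :: p), {subset x :: p <= T} & size p = n].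
  elim: n => [|n [x [p [ep up pT sp]]]].
    by exists v0, [::]; split=> // x; rewrite inE => /eqP->.
  have [a [b [aT bT xa xb ab]]] := two x (pT x (mem_head _ _)).
  have grow c : c \in T -> e x c -> c \notin p -> exists x0 p0,
      [/\ path e x0 p0, uniq (x0 :: p0), {subset x0 :: p0 <= T} & size p0 = n.+1].
    move=> cT xc cp; exists c, (x :: p); split=> /=; rewrite ?sp //.
    - by rewrite e_sym xc.
    - rewrite inE negb_or cp andbT andbC; apply/andP; split=> //.
      by apply: contraTneq xc => ->; rewrite e_irr.
    - by move=> z; rewrite inE => /orP[/eqP->|/pT].
  have [ap|] := boolP (a \in p); last exact: grow.
  have [bp|] := boolP (b \in p); last exact: grow.
  by rewrite (closes x p a) // (closes x p b) // eqxx in ab.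
have [x [p [_ up _ sp]]] := long #|V|.
by have := max_card (mem (x :: p)); rewrite (card_uniqP up) /= sp ltnn.
Qed.

Lemma disintegration (R : realFieldType) (W : finType) (p q : W -> R)
    (f : W -> W -> R) :
  (forall x, 0 <= p x) -> (forall y, 0 <= q y) -> \sum_y q y = 1 ->
  (forall x y, 0 <= f x y) -> (forall x, \sum_y f x y = p x) ->
  exists k : W -> W -> R,
    [/\ forall x y, 0 <= k x y, forall x, \sum_y k x y = 1 &
        forall x y, p x * k x y = f x y].
Proof.
move=> p0 q0 q1 f0 fp.
(* On rows of mass zero any probability vector serves; [q] is one at hand. *)
exists (fun x y => if p x == 0 then q y else f x y / p x); split=> [x y|x|x y].
- by have [_|_] := eqVneq (p x) 0; rewrite ?divr_ge0.
- by have [_|px] := eqVneq (p x) 0; rewrite // -mulr_suml fp divff.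
- have [px|px] := eqVneq (p x) 0; last by rewrite mulrC divfK.
  rewrite px mul0r; apply/esym.
  have sum0 : \sum_y f x y = 0 by rewrite fp.
  by apply: (psumr_eq0P _ sum0).
Qed.

Definition update (V W : finType) (w : {ffun V -> W}) (l : V) (s : W) :=
  [ffun v => if v == l then s else w v].

(** [nu] is the image of the joint law [mu w * K w s] under [update]: coordinate [l] is redrawn from
    the kernel [K]. *)
Lemma resample (R : realFieldType) (V W : finType) (mu : {ffun V -> W} -> R)
    (l : V) (K : {ffun V -> W} -> W -> R) :
  (forall w, 0 <= mu w) -> (forall w s, 0 <= K w s) ->
  exists nu : {ffun V -> W} -> R,
  [/\ forall w, 0 <= nu w,
      forall w, nu w != 0 ->
        exists w' s, [/\ mu w' != 0, K w' s != 0 & w = update w' l s] &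
      forall Q : pred {ffun V -> W}, \sum_(w | Q w) nu w =
        \sum_w \sum_(s | Q (update w l s)) mu w * K w s].
Proof.
move=> mu0 K0.
exists (fun w => \sum_w' \sum_(s | w == update w' l s) mu w' * K w' s).
have pos w w' : 0 <= \sum_(s | w == update w' l s) mu w' * K w' s.
  by apply: sumr_ge0 => s _; rewrite mulr_ge0.
split=> [w|w nz|Q].
- exact: sumr_ge0.
- apply: contrapT => H; move/eqP: nz; apply; apply: big1 => w' _.
  apply: big1 => s /eqP ws; apply/eqP; rewrite mulf_eq0.
  apply/negPn/negP; rewrite negb_or => /andP[mw Kw].
  by apply: H; exists w', s.
- rewrite exchange_big; apply: eq_bigr => w _ /=.
  rewrite (exchange_big_dep (fun s => Q (update w l s))) /=; last first.
    by move=> v s Qv /eqP<-.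
  by apply: eq_bigr => s Qs; rewrite (big_pred1 (update w l s)) // => v;
    rewrite /= andbC; case: eqP => // ->.
Qed.

Lemma glue_forest (R : realFieldType) (V W : finType) (e : rel V)
    (r : V -> V -> rel W) (p : V -> W -> R) :
  symmetric e -> irreflexive e ->
  (forall c : seq V, (2 < size c)%N -> ~ ucycle e c) ->
  (forall a x, 0 <= p a x) -> (forall a, \sum_x p a x = 1) ->
  (forall a b x y, r a b x y = r b a y x) ->
  (forall a b, e a b -> exists f : W -> W -> R,
    [/\ forall x y, 0 <= f x y, forall x y, f x y != 0 -> r a b x y,
        forall x, \sum_y f x y = p a x & forall y, \sum_x f x y = p b y]) ->
  forall T : {set V}, exists mu : {ffun V -> W} -> R,
    [/\ forall w, 0 <= mu w, \sum_w mu w = 1,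
        forall a s, a \in T -> \sum_(w : {ffun V -> W} | w a == s) mu w = p a s &
        forall w, mu w != 0 -> forall a b, a \in T -> b \in T -> e a b ->
          r a b (w a) (w b)].
Proof.
move=> e_sym e_irr acyc p0 p1 r_sym coupling T.
have [n] := ubnP #|T|; elim: n T => // n IHn T Tn.
have [T0|[v0 v0T]] := set_0Vmem T.
  (* The law lives on total functions, so even for empty [T] one must be exhibited: a point mass, or
     the unique function when [V] is empty. *)
  have [v0|V0] := pickP (fun _ : V => true).
    have [s0|W0] := pickP (fun _ : W => true); last first.
      by move: (p1 v0); rewrite big_pred0 // => /esym/eqP; rewrite oner_eq0.
    exists (fun w => if w == [ffun _ => s0] then 1 else 0); split.
    - by move=> w; case: ifP.
    - by rewrite -big_mkcond (big_pred1 [ffun _ => s0]).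
    - by move=> a s; rewrite T0 finset.in_set0.
    - by move=> w _ a b; rewrite T0 finset.in_set0.
  exists (fun _ => 1); split=> //; last first.
  - by move=> w _ a; have := V0 a.
  - by move=> a; have := V0 a.
  rewrite sumr_const card_ffun (_ : #|V| = 0) //.
  by apply: eq_card0 => v; have := V0 v.
have [l lT leaf] := acyclic_has_leaf e_sym e_irr acyc v0T.
have [|mu [mu0 mu1 mup mur]] := IHn (T :\ l).
  by move: Tn; rewrite (cardsD1 l) lT.
have [K [K0 K1 Kp Kr]] : exists K : {ffun V -> W} -> W -> R,
    [/\ forall w s, 0 <= K w s, forall w, \sum_s K w s = 1,
        forall s, \sum_w mu w * K w s = p l s &
        forall w s, mu w != 0 -> K w s != 0 ->
          forall b, b \in T -> e l b -> r l b s (w b)].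
  have [/existsP[b /andP[bT lb]]|nob] := boolP [exists b in T, e l b];
      last first.
    (* With no neighbor in [T], the value at [l] is drawn independently of the rest. *)
    exists (fun _ => p l); split=> // [s|w s _ _ b bT lb].
      by rewrite -mulr_suml mu1 mul1r.
    by move: nob; rewrite negb_exists => /forallP/(_ b); rewrite bT lb.
  have bTl : b \in T :\ l.
    by rewrite in_setD1 bT andbT; apply: contraTneq lb => ->; rewrite e_irr.
  (* Draw the value at [l] from its conditional law given [w b]; averaging over [mu], whose marginal
     at [b] is [p b], returns the second marginal [p l]. *)
  have [|f [f0 fr fb fl]] := coupling b l; first by rewrite e_sym.
  have [k [k0 k1 kf]] := disintegration (p0 b) (p0 l) (p1 l) f0 fb.
  exists (fun w => k (w b)); split=> // [s|w s mw ks c cT lc].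
    rewrite (partition_big (fun w : {ffun V -> W} => w b) predT) //=.
    rewrite -fl; apply: eq_bigr => x _; rewrite -kf -(mup b) // mulr_suml.
    by apply: eq_bigr => w /eqP->.
  have -> : c = b by apply: leaf.
  rewrite r_sym; apply: fr; rewrite -kf mulf_neq0 // -(mup b) //.
  by rewrite psumr_neq0 //; apply/hasP; exists w; rewrite ?mem_index_enum //= eqxx
    lt_neqAle eq_sym mw mu0.
have [nu [nu0 nus nuQ]] := resample l mu0 K0.
exists nu; split=> //.
- rewrite (nuQ predT) -mu1; apply: eq_bigr => w _.
  by rewrite -mulr_sumr K1 mulr1.
- move=> a s aT; rewrite nuQ; have [->|al] := eqVneq a l.
    rewrite -Kp; apply: eq_bigr => w _; rewrite (big_pred1 s) // => t.
    by rewrite /update ffunE eqxx.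
  rewrite -(mup a); last by rewrite in_setD1 al.
  rewrite [RHS]big_mkcond; apply: eq_bigr => w _.
  under eq_bigl do rewrite /update ffunE (negbTE al).
  by case: eqP => _; [rewrite -mulr_sumr K1 mulr1 | rewrite big_pred0].
- move=> w /nus[w' [s [mw' Ks ->]]] a b aT bT ab; rewrite /update !ffunE.
  have [al|al] := eqVneq a l; have [bl|bl] := eqVneq b l.
  + by move: ab; rewrite al bl e_irr.
  + by rewrite al; apply: Kr; rewrite // -al.
  + by rewrite bl r_sym; apply: Kr; rewrite // -bl e_sym.
  + by apply: mur; rewrite // in_setD1 ?al ?bl.
Qed.

(** * Probability measures on finite sets *)

Local Open Scope classical_set_scope.

Lemma pmf_probability (R : realType) (T : finType) (x0 : T) (mu : T -> R) :
  (forall t, 0 <= mu t) -> \sum_t mu t = 1 ->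
  exists P : probability (discrete_space x0) R,
    forall U : set T, P U = (\sum_(t | t \in U) mu t)%:E.
Proof.
move=> mu0 mu1.
pose m : {measure set (discrete_space x0) -> \bar R} := msum (fun k =>
  mscale (NngNum (mu0 (nth x0 (enum T) k)))
  (dirac (nth x0 (enum T) k : discrete_space x0))) #|T|.
have mE U : m U = (\sum_(t | t \in U) mu t)%:E.
  rewrite big_mkcond (eq_bigl (mem T)) // big_enum_val -sumEFin.
  apply: eq_bigr => k _; rewrite /= -(enum_val_nth x0 k) /mscale /= diracE.
  by case: (enum_val k \in U); rewrite ?mule1 ?mule0.
have m1 : m [set: discrete_space x0] = 1%E.
  rewrite mE (eq_bigl xpredT) ?mu1 // => t; by rewrite in_setT.
(* The total mass is already 1: normalizing changes no value and supplies the probability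
   structure. *)
exists (mnormalize m (dirac (x0 : discrete_space x0))) => U.
rewrite -mE -[LHS]/(mnormalize m (dirac (x0 : discrete_space x0)) U) /mnormalize.
by rewrite m1 onee_eq0 /= invr1 mule1.
Qed.

Lemma probability_discreteE (R : realType) (T : finType) (x0 : T)
    (P : probability (discrete_space x0) R) (U : set T) :
  P U = (\sum_(t | t \in U) fine (P [set t]))%:E.
Proof.
rewrite -[in LHS](image_id U) -[in LHS]bigcup_imset1.
rewrite (@measure_fin_bigcup _ _ _ P T U (fun t => [set t])) //; last 2 first.
- exact: finite_finset.
- by move=> i j _ _ [t [-> ->]].
rewrite (fsbigE [seq t <- index_enum T | t \in U]).
- rewrite big_filter_cond -sumEFin; apply: eq_big => [t|t _]; first by rewrite andbb.
  by rewrite fineK // fin_num_measure.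
- by rewrite filter_uniq ?index_enum_uniq.
- by move=> t /=; rewrite mem_filter => /andP[/set_mem].
- by move=> t Ut; rewrite mem_filter mem_index_enum andbT => /negP[]; exact: mem_set.
Qed.

(** * Acyclic posets *)

Section AcyclicRealizable.
Context (R : realType) (d : Order.disp_t) (S : finPOrderType d).

Lemma cover_graph_sym : symmetric (@cover_graph d S).
Proof. by move=> x y; rewrite /cover_graph orbC. Qed.

Lemma cover_graph_irr : irreflexive (@cover_graph d S).
Proof. by move=> x; rewrite /cover_graph /covers ltxx. Qed.

Lemma covers_lt (x y : S) : covers y x -> (x < y)%O.
Proof. by case/andP. Qed.

(** Induction on the size of the interval from [a] to [b]: unless [b] covers [a], a point strictly
    between splits it into two smaller intervals. *)
Lemma covers_homo (d' : Order.disp_t) (T : porderType d') (f : S -> T) :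
  (forall a b, covers b a -> f a <= f b)%O -> {homo f : a b / (a <= b)%O}.
Proof.
move=> fc a b.
have [n] := ubnP #|[set z : S | (a <= z <= b)%O]%SET|.
elim: n a b => // n IHn a b abn; rewrite /= [in X in X -> _]le_eqVlt => /orP[/eqP->//|ab].
have [|] := boolP (covers b a); first exact: fc.
rewrite /covers ab /= negbK => /existsP[z /andP[az zb]].
have card_lt (x y : S) : (a <= x)%O -> (y <= b)%O -> (a < x)%O || (y < b)%O ->
    (#|[set t : S | (x <= t <= y)%O]%SET| < n)%N.
  move=> ax yb strict; move: abn; rewrite ltnS; apply: leq_trans; apply: proper_card.
  apply/properP; split.
    apply/fintype.subsetP => t; rewrite !inE => /andP[xt ty].
    by rewrite (le_trans ax xt) (le_trans ty yb).
  case/orP: strict => lt; [exists a|exists b];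
    by rewrite !inE ?lexx ?(ltW ab) //= ?(lt_geF lt) ?andbF.
apply: (@le_trans _ _ (f z)); apply: IHn; rewrite ?(ltW az) ?(ltW zb) //.
  by apply: card_lt; rewrite ?(ltW zb) ?zb ?orbT.
by apply: card_lt; rewrite ?(ltW az) ?az.
Qed.

Lemma acyclic_realizable (x0 : S) (P : S -> probability (discrete_space x0) R) :
  poset_acyclic S -> stochastically_monotone P -> realizably_monotone P.
Proof.
move=> acyc mono.
pose p (a s : S) : R := fine (P a [set s]).
have p0 a s : 0 <= p a s by rewrite fine_ge0.
have p1 a : \sum_s p a s = 1.
  have := probability_setT (P a); rewrite probability_discreteE => -[<-].
  by apply: eq_bigl => t; rewrite in_setT.
have coupling a b : (a <= b)%O -> exists f : S -> S -> R,
    [/\ forall x y, 0 <= f x y, forall x y, f x y != 0 -> (x <= y)%O,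
        forall x, \sum_y f x y = p a x & forall y, \sum_x f x y = p b y].
  move=> ab; apply: strassen => // [|U upU]; first by rewrite !p1.
  have := mono a b ab [set x | x \in U] upU.
  rewrite !probability_discreteE lee_fin; congr (_ <= _);
    by apply: eq_bigl => t; rewrite mem_setE.
(* Cover edges are undirected; [r] recovers the direction from which endpoint covers the other. *)
pose r (a b x y : S) := (covers b a ==> (x <= y)%O) && (covers a b ==> (y <= x)%O).
have [a b x y|a b ab|mu [mu0 mu1 mup mur]] :=
    @glue_forest R S S (@cover_graph d S) r p
      cover_graph_sym cover_graph_irr acyc p0 p1 _ _ [set: S]%SET.
- by rewrite /r andbC.
- have [ba|ba] := boolP (covers b a).
    have [f [f0 fr fa fb]] := coupling a b (ltW (covers_lt ba)).
    exists f; split=> // x y /fr xy; rewrite /r xy implybT /=.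
    apply/implyP => /covers_lt; by rewrite lt_gtF // covers_lt.
  have ab' : covers a b by move: ab; rewrite /cover_graph (negbTE ba) orbF.
  have [f [f0 fr fb fa]] := coupling b a (ltW (covers_lt ab')).
  exists (fun x y => f y x); split=> // x y /fr xy.
  by rewrite /r xy implybT (negbTE ba).
have mono_w w : mu w != 0 -> {homo w : a b / (a <= b)%O}.
  move=> mw; apply: covers_homo => a b ba.
  have /andP[/implyP/(_ ba)] // : r a b (w a) (w b).
  by apply: (mur w mw); rewrite ?finset.in_setT // /cover_graph ba orbT.
have [Pr PrE] := pmf_probability [ffun _ => x0] mu0 mu1.
(* The order must hold at every sample point, not just almost surely, so non-monotone functions,
   which have mass zero, are sent to the constant [x0]. *)
pose good (w : {ffun S -> S}) := [forall a, forall b, (a <= b)%O ==> (w a <= w b)%O].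
pose eval a (w : discrete_space [ffun _ : S => x0]) : discrete_space x0 :=
  if good w then (w : {ffun S -> S}) a else x0.
have meval a : measurable_fun [set: discrete_space [ffun _ : S => x0]] (eval a).
  by [].
pose X a : {RV Pr >-> discrete_space x0} :=
  HB.pack (eval a) (isMeasurableFun.Build _ _ _ _ (eval a) (meval a)).
exists _, _, Pr, X; split.
- move=> a b ab w; rewrite /X /= /eval; case: ifP => // /forallP/(_ a)/forallP/(_ b).
  by rewrite ab.
- move=> a U; rewrite /distribution /pushforward PrE probability_discreteE.
  congr (_%:E); under [RHS]eq_bigr do rewrite -/(p a _) -mup ?finset.in_setT //.
  rewrite (exchange_big_dep predT) //= big_mkcond; apply: eq_bigr => w _.
  have [mw0|mw] := eqVneq (mu w) 0; first by rewrite mw0 big1 ?if_same.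
  have evalE : eval a w = w a.
    rewrite /eval ifT //; apply/forallP => b; apply/forallP => c.
    by apply/implyP; exact: mono_w.
  have -> : (w \in eval a @^-1` U) = (w a \in U).
    by rewrite -evalE; apply/idP/idP => /set_mem wU; exact: mem_set.
  case: ifPn => wU.
    rewrite (big_pred1 (w a)) // => s /=; rewrite [in RHS]eq_sym.
    by case: eqP => [<-|]; rewrite ?wU ?andbF.
  by rewrite big_pred0 // => s; case: eqP => [<-|]; rewrite ?andbF ?(negbTE wU).
Qed.
End AcyclicRealizable.

(** * Antitone maps winding around a cycle *)

Local Open Scope order_scope.

(** Meant for the capped fence distances of two elements, that of the lower one being [i]. The
    alternatives are the edges of the cycle on 0..M, odd positions below even ones; the last is the
    closing edge. *)
Lemma fence_adjacent (M i j : nat) : (i <= M)%N -> (j <= M)%N ->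
  ((i < M)%N -> ~~ odd i -> (j <= i)%N) -> ((j < M)%N -> odd j -> (i <= j)%N) ->
  ((i < M)%N -> (j <= i.+1)%N) -> ((j < M)%N -> (i <= j.+1)%N) ->
  i = j \/ [/\ odd i, ~~ odd j & [\/ i = j.+1, j = i.+1 | i = M /\ j = 0%N]].
Proof.
move=> iM jM i_even j_odd iS jS; case: (ltngtP i j) => [ij|ji|->]; last by left.
- have i_lt := leq_trans ij jM.
  have ji : j = i.+1 by apply/eqP; rewrite eqn_leq iS.
  have i_odd : odd i by apply/negPn/negP => /(i_even i_lt); rewrite leqNgt ij.
  by right; rewrite ji /= i_odd; split=> //; apply: Or32.
- have j_lt := leq_trans ji iM.
  have ij : i = j.+1 by apply/eqP; rewrite eqn_leq jS.
  have j_even : ~~ odd j by apply/negP => /(j_odd j_lt); rewrite leqNgt ji.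
  by right; rewrite ij /= j_even; split=> //; apply: Or31.
Qed.

Section Winding.
Context {d : Order.disp_t} (S : finPOrderType d).

(* [c] is a closed walk along which the hole [q (c i)] visits every point of the
   image of [q] once, moving along covers of that image. *)
Definition antitone_winding (n : nat) (q : S -> S) (c : nat -> S) : Prop :=
  [/\ (2 < n)%N, {homo q : x y /~ x <= y}, c n = c 0%N /\
      (forall i, (i < n)%N -> c i >=< c i.+1),
      (forall i j, (i < n)%N -> (j < n)%N -> q (c i) = q (c j) -> i = j) &
      (forall x, exists2 i, (i < n)%N & q x = q (c i)) /\
      (forall i x, (i < n)%N -> ~~ (q (c i) < q x < q (c i.+1)) /\
         ~~ (q (c i.+1) < q x < q (c i)))].

Lemma diamond_winding (x y z w : S) :
  x <= y -> y <= w -> x <= z -> z <= w -> ~~ (y >=< z) ->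
  exists n q c, antitone_winding n q c.
Proof.
move=> xy yw xz zw /norP[yz zy].
have xy' : x < y by rewrite lt_neqAle xy andbT; apply: contraNneq yz => <-.
have xz' : x < z by rewrite lt_neqAle xz andbT; apply: contraNneq zy => <-.
have yw' : y < w by rewrite lt_neqAle yw andbT; apply: contraNneq zy => ->.
have zw' : z < w by rewrite lt_neqAle zw andbT; apply: contraNneq yz => ->.
have xw' := lt_trans xy' yw'.
pose q a := if y <= a then (if z <= a then x else z)
            else (if z <= a then y else w).
have qx : q x = w by rewrite /q !lt_geF.
have qy : q y = z by rewrite /q lexx (negbTE zy).
have qz : q z = y by rewrite /q lexx (negbTE yz).
have qw : q w = x by rewrite /q yw zw.
(* The default [x] of [nth] closes the walk at index 4. *)
exists 4, q, (nth x [:: x; y; w; z]); split=> //.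
- move=> a b ba; rewrite /q.
  have tr t : t <= b -> t <= a by move=> /le_trans; apply.
  have := tr y; have := tr z.
  case: (y <= b); case: (z <= b); case: (y <= a); case: (z <= a) => H1 H2 //;
    by [rewrite ?lexx ?xy ?xz ?yw ?zw ?(ltW xw')
       | move: (H1 isT) | move: (H2 isT)].
- split=> // -[|[|[|[|i]]]] //= _; rewrite /Order.comparable ?xy ?yw ?zw ?xz ?orbT //.
- move=> [|[|[|[|i]]]] // [|[|[|[|j]]]] //= _ _; rewrite ?qx ?qy ?qz ?qw => E //;
  by move: xy' xz' yw' zw' xw' yz; rewrite E ?ltxx ?lexx.
- split=> [a|].
    rewrite {1}/q; case: ifP => _; case: ifP => _;
    [exists 2%N|exists 1%N|exists 3%N|exists 0%N]; rewrite //= ?qx ?qy ?qz ?qw.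
  have F (a b : S) : a < b -> (b < a) = false by move=> /lt_gtF.
  have Fyz : (y < z) = false by apply: contraNF yz => /ltW.
  have Fzy : (z < y) = false by apply: contraNF zy => /ltW.
  move=> [|[|[|[|i]]]] // a _ /=; rewrite ?qx ?qy ?qz ?qw;
  rewrite /q; case: ifP => _; case: ifP => _;
  by rewrite ?ltxx ?Fyz ?Fzy ?(F _ _ xy') ?(F _ _ xz') ?(F _ _ yw') ?(F _ _ zw')
    ?(F _ _ xw') ?andbF.
Qed.


(** * Posets whose intervals are chains: winding around a crown *)

Section Crown.
Variables u v : S.
Hypothesis uv : covers v u.
Hypothesis no_diamond : forall x y z w : S,
  x <= y -> y <= w -> x <= z -> z <= w -> y >=< z.

(* Since intervals are chains, this is the order generated by the cover graph
   deprived of the edge [u < v]. *)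
Definition le_avoiding (a b : S) := (a <= b) && ~~ ((a <= u) && (v <= b)).

Let ltuv : u < v. Proof. by case/andP: uv. Qed.

Lemma le_avoidingxx a : le_avoiding a a.
Proof.
rewrite /le_avoiding lexx; apply/negP => /andP[au va].
by have := le_lt_trans (le_trans va au) ltuv; rewrite ltxx.
Qed.

(** If [a <= u] and [v <= c], then [b] shares an interval with [u] and with [v], hence is comparable
    to both; being neither below [u] nor above [v], it lies strictly between them, although [v]
    covers [u]. *)
Lemma le_avoiding_trans : transitive le_avoiding.
Proof.
move=> b a c /andP[ab nab] /andP[bc nbc]; rewrite /le_avoiding (le_trans ab bc).
apply/negP => /andP[au vc].
have bu : b >=< u by apply: no_diamond ab bc au (le_trans (ltW ltuv) vc).
have bv : b >=< v by apply: no_diamond ab bc (le_trans au (ltW ltuv)) vc.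
have nbu : ~~ (b <= u) by apply: contra nbc => ->.
have nvb : ~~ (v <= b) by apply: contra nab => ->; rewrite au.
have ub : u < b.
  move: bu; rewrite /Order.comparable (negbTE nbu) /= le_eqVlt => /orP[/eqP ub|//].
  by rewrite ub lexx in nbu.
have bv' : b < v.
  move: bv; rewrite /Order.comparable (negbTE nvb) orbF le_eqVlt => /orP[/eqP vb|//].
  by rewrite vb lexx in nvb.
by case/andP: uv => _ /existsP[]; exists b; rewrite ub.
Qed.

(* [x] is reached from the up-set of [v] by at most [i] steps of [le_avoiding],
   alternately downwards and upwards, starting downwards. *)
Fixpoint fence_within (i : nat) (x : S) : bool :=
  if i is j.+1 then
    [exists y, fence_within j y &&
      (if odd j then le_avoiding y x else le_avoiding x y)]
  else v <= x.

Lemma fence_withinP i x :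
  reflect (exists2 y, fence_within i y &
      if odd i then le_avoiding y x else le_avoiding x y)
    (fence_within i.+1 x).
Proof.
apply: (iffP existsP) => [[y /andP[]]|[y iy yx]]; exists y => //.
exact/andP.
Qed.

Lemma fence_withinS i x : fence_within i x -> fence_within i.+1 x.
Proof.
by move=> ix; apply/fence_withinP; exists x; rewrite // le_avoidingxx if_same.
Qed.

Lemma fence_within_leq i j x : (i <= j)%N -> fence_within i x -> fence_within j x.
Proof.
move=> /subnK <- ix; elim: (j - i)%N => // k; rewrite addSn.
exact: fence_withinS.
Qed.

(** For [le_avoiding], even levels are up-sets and odd levels are down-sets. *)
Lemma fence_within_closed i x y : fence_within i x ->
  (if odd i then le_avoiding y x else le_avoiding x y) -> fence_within i y.
Proof.
case: i => [vx /andP[xy _]|i /fence_withinP[z iz zx]]; first exact: le_trans xy.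
rewrite /= => xy; apply/fence_withinP; exists z => //; move: zx xy.
case: (odd i) => /= zx xy; first exact: le_avoiding_trans xy.
exact: le_avoiding_trans zx.
Qed.

Lemma fence_within_step i x y : fence_within i x ->
  le_avoiding x y || le_avoiding y x -> fence_within i.+1 y.
Proof.
move=> ix; have [io|ie] := boolP (odd i) => /orP[xy|xy].
- by apply/fence_withinP; exists x; rewrite ?io.
- by apply/fence_withinS/(fence_within_closed ix); rewrite io.
- by apply/fence_withinS/(fence_within_closed ix); rewrite (negbTE ie).
- by apply/fence_withinP; exists x; rewrite ?(negbTE ie).
Qed.

Lemma fence_of_within i x : fence_within i x -> exists Q : nat -> S,
  [/\ Q i = x, v <= Q 0%N & forall k, (k < i)%N ->
    if odd k then le_avoiding (Q k) (Q k.+1) else le_avoiding (Q k.+1) (Q k)].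
Proof.
elim: i x => [|i IHi] x; first by move=> vx; exists (fun _ => x).
case/fence_withinP => y /IHi[Q [Qi vQ Qs]] yx.
exists (fun k => if (k <= i)%N then Q k else x); split=> //; first by rewrite ltnn.
move=> k; rewrite ltnS => ki; rewrite ki.
have [->|ki'] := eqVneq k i; first by rewrite ltnn Qi.
by rewrite (_ : (k < i)%N) ?Qs // ltn_neqAle ki' ki.
Qed.

Definition avoiding_edge (a b : S) : bool :=
  [&& cover_graph a b, (a, b) != (u, v) & (a, b) != (v, u)].

Lemma avoiding_edge_comparable a b : avoiding_edge a b ->
  le_avoiding a b || le_avoiding b a.
Proof.
have cov a' b' : covers b' a' -> (a', b') != (u, v) -> le_avoiding a' b'.
  case/andP => ab nab; apply: contraNT; rewrite /le_avoiding (ltW ab) /= negbK.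
  case/andP=> au vb; apply/eqP; congr (_, _); apply/eqP; apply: contraNT nab.
    move=> au'; apply/existsP; exists u.
    by rewrite lt_neqAle au' au (lt_le_trans ltuv vb).
  move=> bv'; apply/existsP; exists v.
  by rewrite (le_lt_trans au ltuv) lt_neqAle vb eq_sym bv'.
case/and3P => /orP[ab|ba] nuv nvu.
  rewrite [X in _ || X]cov ?orbT //; apply: contraNneq nvu => -[-> ->]//.
by rewrite cov.
Qed.
Lemma crown_winding : connect avoiding_edge v u ->
  exists n q c, antitone_winding n q c.
Proof.
move=> /connectP[s vs us].
have within_u : fence_within (size s) u.
  rewrite us; elim/last_ind: s vs {us} => [|s x IHs]; first by rewrite /= lexx.
  rewrite rcons_path last_rcons size_rcons => /andP[/IHs sx].
  by move/avoiding_edge_comparable; exact: fence_within_step.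
have exM : exists i, [exists p, (p <= u) && fence_within i p].
  by exists (size s); apply/existsP; exists u; rewrite lexx.
case: (ex_minnP exM) => M /existsP[p /andP[pu Mp]] Mmin {exM within_u s vs us}.
have M_le i x : x <= u -> fence_within i x -> (M <= i)%N.
  by move=> xu ix; apply: Mmin; apply/existsP; exists x; rewrite xu.
have nvu : ~~ (v <= u) by rewrite lt_geF.
(* If [M] were even, the last step would go up from a point below [p], which would meet the down-set
   of [u] one step earlier. *)
have M_odd : odd M.
  case: M Mp Mmin M_le => [vp _ _|m /fence_withinP[y my yp] _ M_le].
    by rewrite (le_trans vp pu) in nvu.
  rewrite oddS; apply/negP => m_odd; rewrite m_odd in yp.
  have yu : y <= u by apply: le_trans pu; case/andP: yp.
  by have := M_le _ _ yu my; rewrite ltnn.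
(* A single step down from above [v] to below [u] is exactly what [le_avoiding] forbids. *)
have M_gt2 : (2 < M)%N.
  case: M Mp Mmin M_le M_odd => [|[|[|//]]] // /fence_withinP[y vy py] _ _ _.
  by case/andP: py => _; rewrite pu -[v <= y]/(fence_within 0 y) vy.
have [Q [QM vQ Qs]] := fence_of_within Mp.
(* [find] returns [M] when no level below [M] contains [x], which caps the distance. *)
pose f x := find (fun i => fence_within i x) (iota 0 M).
have f_le x : (f x <= M)%N by rewrite -[M in (_ <= M)%N](size_iota 0) find_size.
have f_min i x : fence_within i x -> (f x <= i)%N.
  move=> ix; have [iM|Mi] := ltnP i M; last exact: leq_trans (f_le _) Mi.
  rewrite leqNgt; apply/negP => /(before_find 0%N).
  by rewrite nth_iota // add0n ix.
have f_within x : (f x < M)%N -> fence_within (f x) x.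
  move=> fM; have := nth_find 0%N (a := fun i => fence_within i x) (s := iota 0 M).
  by rewrite has_find size_iota fM nth_iota // => /(_ isT).
(* A fence point reached one step early makes all later ones early, up to [Q M = p], against the
   minimality of [M]. *)
have Q_near k : (k < M)%N -> fence_within k (Q k.+1) -> fence_within M.-1 (Q M).
  move=> kM kQ.
  have Qk j : (k + j < M)%N -> fence_within (k + j) (Q (k + j).+1).
    elim: j => [|j IHj] kj; rewrite ?addn0 // addnS.
    apply: fence_withinS; apply: (fence_within_closed (IHj _)); first lia.
    have := Qs (k + j).+1; rewrite -addnS kj => /(_ isT); rewrite addnS /=.
    by case: (odd (k + j)).
  have := Qk (M.-1 - k)%N; rewrite subnKC; last lia.
  by rewrite prednK; [apply|]; lia.
have Q_within k : (k <= M)%N -> fence_within k (Q k).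
  elim: k => // k IHk kM; apply: (fence_within_step (IHk (ltnW kM))).
  by have := Qs k kM; case: (odd k) => ->; rewrite ?orbT.
have fQ k : (k <= M)%N -> f (Q k) = k.
  move=> kM; apply/eqP; rewrite eqn_leq f_min ?Q_within //=.
  rewrite leqNgt; apply/negP => fk.
  have kf : fence_within k.-1 (Q k.-1.+1).
    rewrite prednK; last by lia.
    by apply: fence_within_leq (f_within _ _); lia.
  have := Q_near k.-1 _ kf; rewrite QM => /(_ ltac:(lia)) /(M_le _ _ pu); lia.
have f_mono x y : x <= y -> f x = f y \/
    [/\ odd (f x), ~~ odd (f y) &
      [\/ f x = (f y).+1, f y = (f x).+1 | f x = M /\ f y = 0%N]].
  move=> xy; have [/andP[xu vy]|nxy] := boolP ((x <= u) && (v <= y)).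
    right; have -> : f y = 0%N by apply/eqP; rewrite -leqn0; exact: f_min.
    have -> : f x = M; last by split=> //; apply: Or33.
    apply/eqP; rewrite eqn_leq f_le leqNgt; apply/negP => fxM.
    by move: (M_le _ _ xu (f_within _ fxM)); rewrite leqNgt fxM.
  have av : le_avoiding x y by rewrite /le_avoiding xy.
  have fx_even : (f x < M)%N -> ~~ odd (f x) -> (f y <= f x)%N.
    move=> fxM ev; apply: f_min; apply: (fence_within_closed (f_within _ fxM)).
    by rewrite (negbTE ev).
  have fy_odd : (f y < M)%N -> odd (f y) -> (f x <= f y)%N.
    move=> fyM od; apply: f_min; apply: (fence_within_closed (f_within _ fyM)).
    by rewrite od.
  have fx_step : (f x < M)%N -> (f y <= (f x).+1)%N.
    move=> fxM; apply: f_min; apply: (fence_within_step (f_within _ fxM)).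
    by rewrite av.
  have fy_step : (f y < M)%N -> (f x <= (f y).+1)%N.
    move=> fyM; apply: f_min; apply: (fence_within_step (f_within _ fyM)).
    by rewrite av orbT.
  exact: fence_adjacent fx_even fy_odd fx_step fy_step.
(* As [M] is odd, the reflection of positions exchanges parities, hence the two levels of the
   crown. *)
pose q x := Q (M - f x)%N.
pose c i := if i == M.+1 then Q 0%N else Q i.
have cE i : (i <= M)%N -> c i = Q i by rewrite /c; case: eqP => // ->; rewrite ltnn.
have qc i : (i <= M)%N -> q (c i) = Q (M - i)%N by move=> iM; rewrite cE // /q fQ.
have Q_lt i j : (i <= M)%N -> (j <= M)%N -> Q i < Q j -> odd i && ~~ odd j.
  move=> iM jM ij; have := f_mono _ _ (ltW ij); rewrite !fQ //.
  by case=> [E|[-> ->]//]; rewrite E ltxx in ij.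
(* A crown has no chain of three elements, so nothing in the image of [q] lies strictly between two
   others. *)
have Q_lt2 i j k : ~~ (Q (M - i)%N < Q (M - j)%N < Q (M - k)%N).
  apply/negP => /andP[/Q_lt ij /Q_lt jk].
  have /andP[_] := ij (leq_subr _ _) (leq_subr _ _).
  by have /andP[->] := jk (leq_subr _ _) (leq_subr _ _).
exists M.+1, q, c; split.
- exact: ltnW.
- move=> x y; rewrite /q => /f_mono; have := f_le x; have := f_le y.
  move=> fyM fxM [->//|[xo ye [xy|xy|[-> ->]]]].
  + have ev : ~~ odd (M - f y) by rewrite oddB // M_odd xo.
    have := Qs (M - f y)%N; rewrite (negbTE ev) (_ : (M - f y).+1 = M - f x)%N;
      last by lia.
    by case/(_ ltac:(lia))/andP.
  + have od : odd (M - f x) by rewrite oddB // M_odd (negbTE ye).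
    have := Qs (M - f x)%N; rewrite od (_ : (M - f x).+1 = M - f y)%N; last by lia.
    by case/(_ ltac:(lia))/andP.
  + by rewrite subn0 subnn QM (le_trans pu) // (le_trans (ltW ltuv)).
- split=> [|i]; first by rewrite /c eqxx.
  rewrite ltnS => iM; have [iM'|Mi] := ltnP i M.
    rewrite !cE //; have := Qs i iM'; rewrite /Order.comparable.
    by case: (odd i) => /andP[->]; rewrite ?orbT.
  have -> : i = M by apply/eqP; rewrite eqn_leq iM.
  by rewrite {2}/c eqxx cE // /Order.comparable QM (le_trans pu) //
    (le_trans (ltW ltuv)).
- move=> i j; rewrite !ltnS => iM jM; rewrite !qc // => /(congr1 f).
  by rewrite !fQ ?leq_subr //; lia.
- split=> [x|i x _].
    by exists (f x); rewrite ?ltnS // qc.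
  by split; exact: Q_lt2.
Qed.
End Crown.

Lemma cycle_avoiding_edge (x y : S) (s : seq S) : (0 < size s)%N ->
  ucycle (@cover_graph d S) [:: x, y & s] ->
  cover_graph x y /\
  connect (avoiding_edge x y) y x.
Proof.
case: s => // z s _ /andP[/= /and3P[xy yz zs]].
rewrite !inE !negb_or => /and4P[/and3P[xy' xz xs] /andP[yz' ys] zs' us].
split=> //; apply/connectP; exists (z :: rcons s x); last by rewrite /= last_rcons.
rewrite /= /avoiding_edge yz !xpair_eqE eqxx (eq_sym y x) (negbTE xy').
rewrite (eq_sym z x) (negbTE xz) /=.
(* Beyond [z] the walk never returns to [y], so it cannot use the removed edge. *)
apply: sub_in_path zs => [a b ay by_ ab|].
  have {}ay : a != y := ay; have {}by_ : b != y := by_.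
  by rewrite /avoiding_edge ab !xpair_eqE (negbTE ay) (negbTE by_) ?andbF.
rewrite /= eq_sym yz' all_rcons xy' /=; apply/allP => t ts.
by apply: contraNneq ys => <-.
Qed.

Lemma cyclic_winding : ~ poset_acyclic S ->
  exists n q c, antitone_winding n q c.
Proof.
move=> cyc.
have [dia|nodia] := pselect (exists x y z w : S,
  [/\ x <= y, y <= w, x <= z, z <= w & ~~ (y >=< z)]).
  by case: dia => x [y [z [w []]]]; exact: diamond_winding.
have no_diamond (x y z w : S) : x <= y -> y <= w -> x <= z -> z <= w -> y >=< z.
  move=> xy yw xz zw; apply/negPn/negP => yz.
  by apply: nodia; exists x, y, z, w.
have [c [c2 cc]] : exists c : seq S, (2 < size c)%N /\ ucycle (@cover_graph d S) c.
  apply: contrapT => H; apply: cyc => c c2 cc; apply: H; by exists c.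
case: c => [|x [|y s]] // in c2 cc; rewrite !ltnS in c2.
have [/orP[yx|xy] con] := cycle_avoiding_edge c2 cc; last exact: crown_winding con.
apply: (crown_winding yx no_diamond).
have avC : avoiding_edge x y =2 avoiding_edge y x.
  by move=> a b; rewrite /avoiding_edge [X in _ && X]andbC.
have avS : symmetric (avoiding_edge y x).
  move=> a b; rewrite /avoiding_edge /cover_graph orbC !xpair_eqE.
  by rewrite [X in _ && X]andbC (andbC (a == x)) (andbC (a == y)).
by rewrite (sym_connect_sym avS) -(eq_connect avC).
Qed.

End Winding.

(** * Failure of realizability on cyclic posets *)

(* [e i] is the position of the hole and [y i] that of a token at time [i]. *)
Lemma moving_hole_shifts (T : Type) (n : nat) (e y : nat -> T) :
  (2 < n)%N -> e n = e 0%N ->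
  (forall i j, (i < n)%N -> (j < n)%N -> e i = e j -> i = j) ->
  (exists2 j, (j < n)%N & y 0%N = e j) ->
  (forall i, (i <= n)%N -> y i <> e i) ->
  (forall i, (i < n)%N -> y i.+1 = y i \/ y i = e i.+1 /\ y i.+1 = e i) ->
  y n <> y 0%N.
Proof.
move=> n2 en einj [j jn y0] hole step.
have j0 : (0 < j)%N.
  by case: j jn y0 => // _ y0; case: (hole 0%N).
(* The token waits at [e j] until the hole arrives at time [j], then moves back to [e j.-1]. It
   stays there to the end, unless [j = 1], when the returning hole sends it to [e n.-1]; this
   differs from [e 1] because [2 < n]. *)
have before i : (i < j)%N -> y i = e j.
  elim: i => // i IHi ij; have [|->|[yi _]] := step i; first lia.
    by apply: IHi; lia.
  have /einj : e i.+1 = e j by rewrite -yi IHi //; lia.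
  lia.
have yj : y j = e j.-1.
  have [|yj|[_ yj]] := step j.-1; first lia.
    by case: (hole j); [lia | rewrite -(prednK j0) yj before; [rewrite prednK|lia]].
  by rewrite -yj prednK.
have after i : (j <= i < n)%N -> y i = e j.-1.
  elim: i => [|i IHi] ij; first lia.
  have [ji|ji] := leqP j i; last by rewrite (_ : i.+1 = j) //; lia.
  have [|->|[yi _]] := step i; [lia | by apply: IHi; lia|].
  have /einj : e i.+1 = e j.-1 by rewrite -yi IHi //; lia.
  lia.
have yn1 : y n.-1 = e j.-1 by apply: after; lia.
rewrite y0; have [|ynn|[ynn yn]] := step n.-1; first lia.
  by rewrite prednK ?yn1 in ynn; [rewrite ynn => /einj; lia | lia].
rewrite prednK ?en in ynn yn; try lia.
rewrite yn => /einj; move: ynn; rewrite yn1 => /einj; lia.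
Qed.

(** * Sample points of a realization *)

Section Realization.
Context (R : realType) (dA dS : Order.disp_t).
Context (A : finPOrderType dA) (S : finPOrderType dS) (x0 : S).

(** One outcome outside finitely many null events gives [w]. For the last clause, [X a] in [U]
    forces [X b] in [U]; if both events have equal probability, their difference is null. *)
Lemma realization_sample (P : A -> probability (discrete_space x0) R) :
  realizably_monotone P -> exists w : A -> S,
    [/\ {homo w : a b / a <= b},
        forall a, P a [set w a] <> 0%E &
        forall a b (U : {set S}), a <= b -> up_set [set` U] ->
          P a [set` U] = P b [set` U] -> w b \in U -> w a \in U].
Proof.
move=> [d [T [Pr [X [Xmono XP]]]]].
have mX a U : measurable (X a @^-1` U) by exact: measurable_funPTI.
have Pr_gt0 : (0 < Pr [set: T])%E by rewrite probability_setT lte01.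
have proper : ProperFilter (almost_everywhere Pr).
  exact: ae_properfilter_algebraOfSetsType.
have null : \forall o \ae Pr, forall a s, P a [set s] = 0%E -> X a o <> s.
  apply: filter_forall => a; apply: filter_forall => s.
  have [Pas|Pas] := pselect (P a [set s] = 0%E); last by apply: aeW.
  exists (X a @^-1` [set s]); split=> //; first by rewrite -XP in Pas.
  by move=> o /= /not_implyP[_ /contrapT].
have stuck : \forall o \ae Pr, forall a b (U : {set S}), a <= b ->
    up_set [set` U] -> P a [set` U] = P b [set` U] ->
    (X b o : S) \in U -> (X a o : S) \in U.
  apply: filter_forall => a; apply: filter_forall => b; apply: filter_forall => U.
  have [[ab [upU PU]]|no] := pselect (a <= b /\ up_set [set` U] /\
    P a [set` U] = P b [set` U]); last by apply: aeW => o ab upU PU; case: no.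
  exists (X b @^-1` [set` U] `\` X a @^-1` [set` U]); split.
  - exact: measurableD.
  - rewrite measureD //; last first.
      by rewrite (le_lt_trans (probability_le1 _ _)) // ltry.
    have sub : X a @^-1` [set` U] `<=` X b @^-1` [set` U].
      by move=> o Uo; apply: upU Uo (Xmono _ _ ab o).
    rewrite (classical_sets.setIidr sub).
    rewrite -[X in (X - _)%E]/(distribution Pr (X b) [set` U]).
    rewrite -[X in (_ - X)%E]/(distribution Pr (X a) [set` U]).
    by rewrite !XP PU subee // fin_num_measure.
  - move=> t /= H; split; last by move=> Ua; apply: H.
    by apply: contrapT => nUb; apply: H => _ _ _ /nUb.
have [t [onull ostuck]] := filter_ex (filterI null stuck).
exists (fun a => X a t); split=> [a b ab|a Pa|a b U ab upU PU].
- exact: Xmono.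
- exact: (onull _ _ Pa).
- exact: ostuck.
Qed.

End Realization.

(** * Uniform laws with a moving hole *)

Section Deficient.
Context (R : realType) (d : Order.disp_t) (S : finPOrderType d).

(** [P a] is uniform on [C] minus [a], so [e] is the inverse of [#|C| - 1]. In this form [P a U]
    depends on [a] only through whether [U] contains it. *)
Lemma deficient_uniform (x0 : S) (C : {set S}) : (1 < #|C|)%N ->
  exists2 e : R, (0 < e)%R & exists P : S -> probability (discrete_space x0) R,
    forall a (U : set S), a \in C -> P a U =
      (\sum_(t | t \in U) (if t \in C then e else 0)
        - (if a \in U then e else 0))%R%:E.
Proof.
move=> C1; pose e : R := (#|C|.-1%:R)^-1%R.
have e_gt0 : (0 < e)%R by rewrite invr_gt0 ltr0n; lia.
exists e => //.
suff /choice[P PE] : forall a, exists Pa : probability (discrete_space x0) R,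
    forall U : set S, a \in C -> Pa U =
      (\sum_(t | t \in U) (if t \in C then e else 0)
        - (if a \in U then e else 0))%R%:E by exists P => a U; exact: PE.
move=> a; have [aC|aC] := boolP (a \in C); last first.
  by exists (dirac (x0 : discrete_space x0)).
have [||Pa PaE] := @pmf_probability R S x0 (fun t =>
  (if t \in C then e else 0) - (if t == a then e else 0))%R.
- move=> t; case: eqP => [->|_]; first by rewrite aC subrr.
  by rewrite subr0; case: ifP => _; rewrite ?(ltW e_gt0).
- rewrite sum_sub_point -big_mkcond /= sumr_const -mulr_natr /e -[X in (_ - X)%R]mulr1.
  rewrite -mulrBr (_ : #|C|%:R - 1 = #|C|.-1%:R)%R ?mulVf //.
    by rewrite pnatr_eq0; lia.
  by rewrite -[in LHS](@prednK #|C|) -?natr1 ?addrK //; lia.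
by exists Pa => U _; rewrite PaE sum_sub_point.
Qed.

Lemma winding_not_equivalence n q (c : nat -> S) :
  antitone_winding n q c -> ~ monotonicity_equivalence R S S.
Proof.
case=> n2 anti [cn ccomp] qinj [qC qbetween] equiv.
pose C : {set S} := [set q x | x in S]%SET.
have inC x : q x \in C by apply/imsetP; exists x.
have C1 : (1 < #|C|)%N.
  have qc01 : q (c 0%N) != q (c 1%N).
    by apply/eqP => /qinj; lia.
  apply: leq_trans (subset_leq_card (_ : [set q (c 0%N); q (c 1%N)]%SET \subset C)).
    by rewrite cards2 qc01.
  by apply/fintype.subsetP => t; rewrite !inE => /orP[]/eqP->.
have [e e_gt0 [P PE]] := deficient_uniform (c 0%N) C1.
(* As [a] grows the hole [q a] descends, so an up-set can only lose it and gain mass. *)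
have mono : stochastically_monotone (fun a => P (q a)).
  move=> a b ab U upU; rewrite !PE // lee_fin lerD2l lerN2.
  case: ifPn => [|_]; last by case: ifP => _; rewrite ?(ltW e_gt0).
  by move=> /set_mem/upU/(_ (anti _ _ ab))/mem_set ->.
have [w [wmono wsupp wstuck]] := realization_sample (equiv _ _ mono).
have wC a : w a \in C.
  apply/negPn/negP => waC; apply: (wsupp a); rewrite PE // big1 => [|t].
    have -> : (q a \in [set w a]) = false; last by rewrite subr0.
    by apply: contraNF waC => /set_mem /= <-.
  by move=> /set_mem/= ->; rewrite (negbTE waC).
have wq a : w a != q a.
  apply/eqP => waq; apply: (wsupp a); rewrite PE // waq (big_pred1 (q a)) => [|t].
    by rewrite inC mem_set //= subrr.
  by apply/idP/eqP => [/set_mem|->]//; exact: mem_set.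
have stuck a b (U : {set S}) : a <= b -> up_set [set` U] ->
    (q a \in U) = (q b \in U) -> w b \in U -> w a \in U.
  move=> ab upU qU; apply: wstuck => //; rewrite !PE //.
  have mU t : (t \in [set` U]) = (t \in U) by rewrite mem_setE.
  by rewrite !mU qU.
(* If the value changes, testing [stuck] on the up-set of [w b] and on the complement of the
   down-set of [w a] confines both values between [q b] and [q a], where [C] has no further
   point. *)
have move_hole a b : a <= b -> (forall x, ~~ (q b < q x < q a)) ->
    w b = w a \/ w a = q b /\ w b = q a.
  move=> ab nobetween; have [->|wab] := eqVneq (w b) (w a); [by left|right].
  have wlt : w a < w b by rewrite lt_neqAle eq_sym wab wmono.
  have qba : q b <= q a by exact: anti.
  have up_le (t : S) : up_set [set` [set x | t <= x]%SET].
    by move=> x y /=; rewrite !inE => tx xy; exact: le_trans xy.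
  have up_nle (t : S) : up_set [set` [set x | ~~ (x <= t)]%SET].
    by move=> x y /=; rewrite !inE => xt xy; apply: contra xt => yt; exact: le_trans yt.
  have qa_ge : w b <= q a.
    apply/negPn/negP => nle; have := stuck a b [set x | w b <= x]%SET ab (up_le _).
    have nqb : (w b <= q b) = false.
      by apply: contraNF nle => wbq; exact: le_trans wbq qba.
    by rewrite !inE lexx (negbTE nle) (lt_geF wlt) nqb => /(_ erefl isT).
  have qb_le : q b <= w a.
    apply/negPn/negP => nle; have := stuck a b [set x | ~~ (x <= w a)]%SET ab (up_nle _).
    have nqa : ~~ (q a <= w a).
      by apply: contra nle => qaw; exact: le_trans qba qaw.
    by rewrite !inE lexx nle nqa (lt_geF wlt) => /(_ erefl isT).
  have /imsetP[x _ wax] := wC a; have /imsetP[y _ wby] := wC b.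
  split; apply/eqP/negPn/negP => ne.
    have := nobetween x; rewrite -wax (lt_le_trans wlt qa_ge) andbT.
    by rewrite lt_neqAle qb_le eq_sym ne.
  have := nobetween y; rewrite -wby (le_lt_trans qb_le wlt) /=.
  by rewrite lt_neqAle qa_ge ne.
apply: (@moving_hole_shifts S n (fun i => q (c i)) (fun i => w (c i))) => //.
- by rewrite cn.
- by have /imsetP[x _ ->] := wC (c 0%N); exact: qC.
- by move=> i _; apply/eqP.
- move=> i ni; have [nb1 nb2] : (forall x, ~~ (q (c i) < q x < q (c i.+1))) /\
      (forall x, ~~ (q (c i.+1) < q x < q (c i))).
    by split=> x; have [] := qbetween i x ni.
  have /orP[le|le] := ccomp i ni.
    by case: (move_hole _ _ le nb2) => ?; [left|right].
  by case: (move_hole _ _ le nb1) => [->|[-> ->]]; [left|right].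
- by rewrite cn.
Qed.

End Deficient.

Theorem theorem4p3 (R : realType) (d : Order.disp_t) (S : finPOrderType d)
    (S_connected : poset_connected S) :
  monotonicity_equivalence R S S <-> poset_acyclic S.
Proof.
split=> [equiv|acyc x0 P]; last exact: acyclic_realizable.
apply: contrapT => /cyclic_winding[n [q [c wind]]].
exact: winding_not_equivalence wind equiv.
Qed.
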